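(* Let $\mu$ be a sub-additive monotone measure on $(X,\mathcal{B})$, and let $\{f_n\}_{n\in\mathbb{N}}$ be a decreasing sequence of nonnegative measurable functions on $X$ converging pointwise to $f$. Let $\mathcal{S}$ be one of the classes $\mathcal{S}^{P+},\ \mathcal{S}^{P+}_\mu,\ \mathcal{S}^{C+},\ \mathcal{S}^{C+}_\mu$, and assume that $\int^{\uparrow}_{\mathcal{S}} f_1\,d\mu<\infty$. Then $$\int^{\uparrow}_{\mathcal{S}} f_n\,d\mu\ \searrow\ \int^{\uparrow}_{\mathcal{S}} f\,d\mu\qquad(n\to\infty),$$ i.e. the integrals are decreasing in $n$ and converge to $\int^{\uparrow}_{\mathcal{S}} f\,d\mu$.
   Context: $(X,\mathcal{B})$ is a measurable space ($\mathcal{B}$ a $\sigma$-algebra on $X$). Measurable functions are real-valued. A monotone measure is a set function $\mu:\mathcal{B}\to[0,\infty)$ with $\mu(\emptyset)=0$ and $\mu(A)\le\mu(B)$ whenever $A\subset B$; throughout, every monotone measure is assumed to be continuous from above and below, i.e. $A_n\nearrow A$ or $A_n\searrow A$ implies $\mu(A_n)\to\mu(A)$. It is sub-additive if $\mu(A\cup B)\le\mu(A)+\mu(B)$ whenever $A,B\in\mathcal{B}$ and $A\cap B=\emptyset$. A simple function is a finite or infinite sequence of pairs $\varphi=\{(a_k,A_k)\}_k$ with $a_k\in\mathbb{R}$, $A_k\in\mathcal{B}$; it is identified with the function $\varphi(x)=\sum_k a_k 1_{A_k}(x)$ ($1_A$ the indicator function of $A$), but its basic sum $\mu(\varphi)=\sum_k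 a_k\mu(A_k)$ depends on the sequence of pairs. A partition of $X$ is a family of pairwise disjoint sets in $\mathcal{B}$ (possibly empty) with union $X$; a covering of $X$ is a family of sets in $\mathcal{B}$ with union $X$. The classes are: - $\mathcal{S}^{P+}$ (resp. $\mathcal{S}^{C+}$): all finite sequences $\{(a_k,A_k)\}_{k=1}^n$, $n\in\mathbb{N}$, with $a_k\ge 0$ and $\{A_k\}_k$ a partition (resp. covering) of $X$; - $\mathcal{S}^{P+}_\mu$ (resp. $\mathcal{S}^{C+}_\mu$): all infinite sequences $\{(a_k,A_k)\}_{k=1}^\infty$ with $a_k\ge 0$, $\sum_k a_k\mu(A_k)<\infty$ and $\{A_k\}_k$ a partition (resp. covering) of $X$. For a class $\mathcal{S}$ and a measurable function $f$, $L(\mathcal{S},f)=\{\varphi\in\mathcal{S}:\varphi(x)\le f(x)\ \forall x\in X\}$ and $\int^{\uparrow}_{\mathcal{S}} f\,d\mu=\sup\{\mu(\varphi):\varphi\in L(\mathcal{S},f)\}$, taken in the extended reals. *)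

(* Defs.v *)
From HB Require Import structures.
From mathcomp Require Import all_boot all_order all_algebra.
From mathcomp Require Import all_classical all_reals all_analysis.

Set Implicit Arguments.
Unset Strict Implicit.
Unset Printing Implicit Defensive.

Import Order.TTheory GRing.Theory Num.Theory.
Import numFieldNormedType.Exports.

Local Open Scope classical_set_scope.
Local Open Scope ring_scope.

(* The set function is total on [set X]; every condition is restricted to
   measurable sets, so its values elsewhere are irrelevant. Continuity from
   above and below is part of the definition. *)
Record monotone_measure (R : realType) (d : measure_display)
    (X : measurableType d) (mu : set X -> R) : Prop := MonotoneMeasure {
  mm_ge0 : forall A, measurable A -> 0 <= mu A ;
  mm_set0 : mu set0 = 0 ;
  mm_le : forall A B, measurable A -> measurable B ->
    A `<=` B -> mu A <= mu B ;
  mm_cont_below : forall A : (set X)^nat, (forall n, measurable (A n)) ->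
    nondecreasing_seq A -> (mu (A n) @[n --> \oo] --> mu (\bigcup_n A n)) ;
  mm_cont_above : forall A : (set X)^nat, (forall n, measurable (A n)) ->
    nonincreasing_seq A -> (mu (A n) @[n --> \oo] --> mu (\bigcap_n A n)) }.

Definition sub_additive (R : realType) (d : measure_display)
    (X : measurableType d) (mu : set X -> R) : Prop :=
  forall A B, measurable A -> measurable B -> A `&` B = set0 ->
    mu (A `|` B) <= mu A + mu B.

(* Finite or infinite sequences of pairs (coefficient, set), as syntactic
   objects: the basic sum depends on the sequence, not only on the function
   it represents. *)
Inductive simple (R : realType) (X : Type) : Type :=
| FinSimple (n : nat) (s : 'I_n -> R * set X)
| InfSimple (s : nat -> R * set X).

(* Extended-real valued because an infinite sum of nonnegative terms may
   diverge; the infinite sums are meant for nonnegative coefficients only. *)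
Definition simple_eval (R : realType) (X : Type) (phi : simple R X) (x : X)
    : \bar R :=
  match phi with
  | FinSimple n s => (\sum_(k < n) ((s k).1 * \1_((s k).2) x)%:E)%E
  | InfSimple s => (\sum_(0 <= k <oo) ((s k).1 * \1_((s k).2) x)%:E)%E
  end.

Definition basic_sum (R : realType) (X : Type) (mu : set X -> R)
    (phi : simple R X) : \bar R :=
  match phi with
  | FinSimple n s => (\sum_(k < n) ((s k).1 * mu (s k).2)%:E)%E
  | InfSimple s => (\sum_(0 <= k <oo) ((s k).1 * mu (s k).2)%:E)%E
  end.

Definition is_covering (d : measure_display) (X : measurableType d)
    (I : Type) (A : I -> set X) : Prop :=
  (forall i, measurable (A i)) /\ \bigcup_i A i = setT.

(* Unlike [classical_sets.partition], blocks may be empty. *)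
Definition is_partition (d : measure_display) (X : measurableType d)
    (I : Type) (A : I -> set X) : Prop :=
  [/\ forall i, measurable (A i), trivIset setT A & \bigcup_i A i = setT].

Definition SPfin (R : realType) (d : measure_display) (X : measurableType d)
    : set (simple R X) :=
  [set phi | match phi with
   | FinSimple n s =>
       (forall k, 0 <= (s k).1) /\ is_partition (fun k => (s k).2)
   | InfSimple _ => False
   end].

Definition SCfin (R : realType) (d : measure_display) (X : measurableType d)
    : set (simple R X) :=
  [set phi | match phi with
   | FinSimple n s =>
       (forall k, 0 <= (s k).1) /\ is_covering (fun k => (s k).2)
   | InfSimple _ => False
   end].

Definition SPinf (R : realType) (d : measure_display) (X : measurableType d)
    (mu : set X -> R) : set (simple R X) :=
  [set phi | match phi with
   | FinSimple _ _ => False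
   | InfSimple s =>
       [/\ forall k, 0 <= (s k).1, (basic_sum mu phi < +oo)%E &
           is_partition (fun k => (s k).2)]
   end].

Definition SCinf (R : realType) (d : measure_display) (X : measurableType d)
    (mu : set X -> R) : set (simple R X) :=
  [set phi | match phi with
   | FinSimple _ _ => False
   | InfSimple s =>
       [/\ forall k, 0 <= (s k).1, (basic_sum mu phi < +oo)%E &
           is_covering (fun k => (s k).2)]
   end].

Definition lower_simple (R : realType) (X : Type) (S : set (simple R X))
    (f : X -> R) : set (simple R X) :=
  [set phi | S phi /\ forall x, (simple_eval phi x <= (f x)%:E)%E].

Definition lower_integral (R : realType) (X : Type) (S : set (simple R X))
    (mu : set X -> R) (f : X -> R) : \bar R :=
  ereal_sup [set basic_sum mu phi | phi in lower_simple S f].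

(* Main.v *)
(** Let [nu A] be the supremum of the sums of [mu] over the finite families of
    disjoint measurable subsets of [A]. Grouping families shows that [nu] is
    super-additive on disjoint sets, and sub-additivity together with continuity
    from below of [mu] makes it countably sub-additive: [nu] is a measure, possibly
    infinite, that dominates [mu]. For each of the four classes the lower integral
    of a nonnegative measurable [f] is the Lebesgue integral of [f] with respect
    to [nu]: a basic sum increases when [mu] is replaced by [nu], and conversely
    the integral of a simple function is approximated by splitting its level sets
    finely. The convergence is then dominated convergence for [nu]. *)

Require Import Defs.
From HB Require Import structures.
From mathcomp Require Import all_boot all_order all_algebra.
From mathcomp Require Import finmap.
From mathcomp Require Import all_classical all_reals all_analysis.
From mathcomp Require Import measurable_realfun.

Set Implicit Arguments.
Unset Strict Implicit.
Unset Printing Implicit Defensive.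

Import Order.TTheory GRing.Theory Num.Theory.
Import numFieldNormedType.Exports.

Local Open Scope classical_set_scope.
Local Open Scope ring_scope.

(** * Countable sub-additivity of the monotone measure *)

(** Finite sub-additivity bounds [mu] on the traces of the partial unions on [B]. These traces
    increase to [B], and continuity from below passes the bound to the limit. *)
Lemma sigma_sub_additive (R : realType) (d : measure_display)
    (X : measurableType d) (mu : set X -> R) (B : set X) (F : (set X)^nat) :
  monotone_measure mu -> sub_additive mu ->
  measurable B -> (forall i, measurable (F i)) -> trivIset setT F ->
  B `<=` \bigcup_i F i ->
  ((mu B)%:E <= \sum_(0 <= i <oo) (mu (B `&` F i))%:E)%E.
Proof.
move=> mm sa mB mF tF BF.
pose G n := B `&` \big[setU/set0]_(i < n) F i.
have mG n : measurable (G n).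
  by apply: measurableI => //; apply: bigsetU_measurable.
have Gle n : mu (G n) <= \sum_(0 <= i < n) mu (B `&` F i).
  elim: n => [|n ih].
    by rewrite /G big_ord0 setI0 big_nil (mm_set0 mm).
  rewrite /G big_ord_recr /= setIUr big_nat_recr //=.
  apply: le_trans (lerD ih (lexx _)).
  apply: sa; [exact: mG|exact: measurableI|].
  rewrite -setIIr; apply/seteqP; split => // x [_ []].
  rewrite -bigcup_mkord => -[i /= lt_in Fix] Fnx.
  have e := tF i n Logic.I Logic.I (ex_intro _ x (conj Fix Fnx)).
  by rewrite e ltnn in lt_in.
have ndG : nondecreasing_seq G.
  apply/nondecreasing_seqP => n; apply/subsetPset.
  by rewrite /G big_ord_recr /= setIUr; exact: subsetUl.
have cG := mm_cont_below mm mG ndG.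
have eG : \bigcup_n G n = B.
  apply/seteqP; split => [x [n _ []] //|x Bx].
  have [i _ Fix] := BF _ Bx.
  (* [G n] stops before index [n], so a point of [F i] enters at stage [i.+1]. *)
  by exists i.+1 => //; split => //; rewrite big_ord_recr /=; right.
rewrite eG in cG.
have cE : (mu (G n))%:E @[n --> \oo] --> (mu B)%:E.
  by apply: cvg_EFin => //; near=> n.
rewrite -(cvg_lim _ cE)//; apply: lime_le; first by apply/cvg_ex; eexists; exact: cE.
near=> n; apply: le_trans (nneseries_lim_ge n _).
  by rewrite sumEFin lee_fin.
by move=> i _ _; rewrite lee_fin; apply: (mm_ge0 mm); apply: measurableI.
Unshelve. all: by end_near.
Qed.

(** * Finite disjoint families below a function and the supremum of their sums *)

Section pan.
Context (R : realType) (d : measure_display) (X : measurableType d).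
Variable mu : set X -> R.
Implicit Types (f g : X -> R) (A B : set X).

(** The sets need not cover [A], so a family in [A] is also one in any larger set. The supremum of
    the basic sums is the pan-integral of [f] over [A]. *)
Definition pan_family f A n (s : 'I_n -> R * set X) : Prop :=
  [/\ forall k, 0 <= (s k).1, forall k, measurable (s k).2,
      trivIset setT (fun k => (s k).2), forall k, (s k).2 `<=` A &
      forall k x, (s k).2 x -> (s k).1 <= f x].

Definition pan_sums f A : set (\bar R) :=
  [set v | exists n (s : 'I_n -> R * set X),
     pan_family f A s /\ v = basic_sum mu (FinSimple s)].

(* [pan (cst 1)] is the measure called [nu] in the header. *)
Definition pan f A : \bar R := ereal_sup (pan_sums f A).

Lemma pan_sums0 f A : pan_sums f A 0%E.
Proof.
exists 0%N, (fun=> (0, set0)); split; last by rewrite /= big_ord0.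
by split=> // -[].
Qed.

Lemma pan_ge0 f A : (0 <= pan f A)%E.
Proof. exact/ereal_sup_ubound/pan_sums0. Qed.

Lemma pan_sums_fin f A v : pan_sums f A v -> v \is a fin_num.
Proof. by move=> [n [s [_ ->]]] /=; rewrite sumEFin. Qed.

Lemma pan_mono f g A B : A `<=` B -> (forall x, A x -> f x <= g x) ->
  (pan f A <= pan g B)%E.
Proof.
move=> AB fg; apply: ereal_sup_le => v [n [s [[s0 ms ts sA sf] ->]]].
exists n, s; split=> //; split=> // [k|k x skx]; first exact: subset_trans AB.
by apply: le_trans (sf _ _ skx) (fg _ _); exact: sA skx.
Qed.

Lemma pan0 f : mu set0 = 0 -> pan f set0 = 0%E.
Proof.
move=> mu0; apply/eqP; rewrite eq_le pan_ge0 andbT.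
apply: ge_ereal_sup => v [n [s [[_ _ _ s0 _] ->]]] /=.
rewrite big1// => k _.
have -> : (s k).2 = set0 by rewrite -subset0; exact: s0.
by rewrite mu0 mulr0.
Qed.

Lemma pan_sumsU f A B v w : A `&` B = set0 ->
  pan_sums f A v -> pan_sums f B w -> pan_sums f (A `|` B) (v + w)%E.
Proof.
move=> AB0 [n [s [[s0 ms ts sA sf] ->]]] [m [t [[t0 mt tt tB tf] ->]]].
pose u (i : 'I_(n + m)) := match fintype.split i with inl k => s k | inr k => t k end.
exists (n + m)%N, u; split; last first.
  rewrite /= big_split_ord /=; congr (_ + _)%E; apply: eq_bigr => k _.
    by rewrite /u (unsplitK (inl _ k)).
  by rewrite /u (unsplitK (inr _ k)).
split=> [k|k||k|k x]; rewrite /u; try by case: fintype.splitP.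
- move=> i j _ _ [x []].
  (* Only the indices in the goal [i = j] are rewritten. Indices from the same family are settled by
     its disjointness, mixed ones by [AB0]. *)
  rewrite -{2}(splitK i) -{2}(splitK j).
  case: (fintype.split i) => k; case: (fintype.split j) => l /= skx tlx.
  + by congr (lshift _ _); apply: ts => //; exists x.
  + by have : (A `&` B) x by [split; [exact: sA skx|exact: tB tlx]]; rewrite AB0.
  + by have : (A `&` B) x by [split; [exact: sA tlx|exact: tB skx]]; rewrite AB0.
  + by congr (rshift _ _); apply: tt => //; exists x.
- case: (fintype.split k) => l x sx; [left; exact: sA sx|right; exact: tB sx].
- by case: (fintype.split k) => l; [exact: sf|exact: tf].
Qed.

Lemma pan_superadd f A B : A `&` B = set0 ->
  (pan f A + pan f B <= pan f (A `|` B))%E.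
Proof.
move=> AB0.
(* A single sum [v] is finite and can be moved across the inequality; the two suprema are taken one
   after the other. *)
have half v : pan_sums f A v -> (v + pan f B <= pan f (A `|` B))%E.
  move=> Av; have vfin := pan_sums_fin Av.
  rewrite addeC -leeBrDr//; apply: ge_ereal_sup => w Bw.
  rewrite leeBrDr// addeC; apply: ereal_sup_ubound; exact: pan_sumsU.
(* Only a finite [pan f B] can be subtracted. If it is infinite, [half] at the zero sum of the empty
   family suffices. *)
have [Boo|Bfin] := eqVneq (pan f B) +oo%E.
  have := half _ (pan_sums0 f A).
  by rewrite add0e Boo leye_eq => /eqP ->; exact: leey.
have {}Bfin : pan f B \is a fin_num.
  by rewrite fin_numElt (lt_le_trans _ (pan_ge0 f B)) ?ltNy0// ltey.
rewrite -leeBrDr//; apply: ge_ereal_sup => v Av.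
by rewrite leeBrDr//; exact: half.
Qed.

Lemma pan_bigsetU f (I : choiceType) (r : seq I) (F : I -> set X) :
  uniq r -> trivIset setT F -> mu set0 = 0 ->
  (\sum_(i <- r) pan f (F i) <= pan f (\big[setU/set0]_(i <- r) F i))%E.
Proof.
move=> + tF mu0; elim: r => [|i r ih]; first by rewrite !big_nil pan0.
move=> /= /andP[ir ur]; rewrite !big_cons.
apply: le_trans (pan_superadd _ _); first exact: leeD2l (ih ur).
apply/seteqP; split => // x [Fix].
rewrite -bigcup_seq => -[j /= jr Fjx].
have ij := tF i j Logic.I Logic.I (ex_intro _ x (conj Fix Fjx)).
by rewrite ij jr in ir.
Qed.

(** Multiplying the coefficients of a family below 1 by [r] gives a family below [f] on [A]. The
    case [r = 0] is separate because the proof divides by [r]. *)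
Lemma pan_scale f A (r : R) : 0 <= r -> (forall x, A x -> r <= f x) ->
  (r%:E * pan (cst 1%R) A <= pan f A)%E.
Proof.
rewrite le_eqVlt => /predU1P[<- _|r0 rf]; first by rewrite mul0e pan_ge0.
rewrite -lee_pdivlMl//; apply: ge_ereal_sup => v [n [s [[s0 ms ts sA s1] ->]]].
rewrite lee_pdivlMl//; apply: ereal_sup_ubound.
exists n, (fun k => (r * (s k).1, (s k).2)); split.
  split=> //= [k|k x skx]; first by rewrite mulr_ge0// ltW.
  by apply: le_trans (rf _ (sA _ _ skx)); rewrite ler_piMr ?(s1 _ _ skx)// ltW.
rewrite /= !sumEFin -EFinM mulr_sumr; congr (_%:E); apply: eq_bigr => k _.
by rewrite mulrA.
Qed.

Lemma le_pan f A (r : R) : 0 <= r -> measurable A ->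
  (forall x, A x -> r <= f x) -> ((r * mu A)%:E <= pan f A)%E.
Proof.
move=> r0 mA rf; apply: ereal_sup_ubound; exists 1%N, (fun=> (r, A)).
split; last by rewrite /= big_ord1.
by split=> //= [i j _ _ _|_ x //]; rewrite (ord1 i) (ord1 j).
Qed.

(** One inequality is [pan_bigsetU] applied to partial unions. For the other, every set of a family
    is cut along the [F i], at a cost controlled by [sigma_sub_additive]. *)
Lemma pan_sigma_additive f : monotone_measure mu -> sub_additive mu ->
  semi_sigma_additive (pan f).
Proof.
move=> mm sa F mF tF _; have mu0 := mm_set0 mm.
have F0 i : (0 <= i)%N -> true -> (0 <= pan f (F i))%E by move=> *; exact: pan_ge0.
suff -> : pan f (\bigcup_n F n) = (\sum_(0 <= i <oo) pan f (F i))%E.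
  exact: is_cvg_nneseries.
apply/eqP; rewrite eq_le; apply/andP; split; last first.
  apply: lime_le; first exact: is_cvg_nneseries.
  near=> n; apply: le_trans (pan_bigsetU _ _ tF mu0) _; first exact: iota_uniq.
  apply: pan_mono => // x; rewrite -bigcup_seq => -[i _ Fix].
  by exists i.
apply: ge_ereal_sup => v [n [s [[s0 ms ts sF sf] ->]]] /=.
apply: (@le_trans _ _
  (\sum_(k < n) \sum_(0 <= i <oo) ((s k).1 * mu ((s k).2 `&` F i))%:E)%E).
  apply: lee_sum => k _; rewrite EFinM.
  under eq_eseriesr do rewrite EFinM.
  rewrite nneseriesZl => [|i _]; last first.
    by rewrite lee_fin (mm_ge0 mm)//; exact: measurableI.
  by rewrite lee_wpmul2l ?lee_fin//; exact: sigma_sub_additive.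
(* After the exchange of sums, the pieces with a fixed [i] form a family inside [F i]. *)
rewrite -nneseries_sum; last first.
  by move=> k i *; rewrite lee_fin mulr_ge0 ?(mm_ge0 mm)//; exact: measurableI.
apply: lee_nneseries => [i _ _|i _].
  by apply: sume_ge0 => k _; rewrite lee_fin mulr_ge0 ?(mm_ge0 mm)//; exact: measurableI.
apply: ereal_sup_ubound; exists n, (fun k => ((s k).1, (s k).2 `&` F i)); split=> //.
split=> //= [k||k x [/sf]//]; first exact: measurableI.
  by move=> j k _ _ [x [[sj _] [sk _]]]; apply: ts => //; exists x.
Unshelve. all: by end_near.
Qed.



Lemma pan_measure f : monotone_measure mu -> sub_additive mu ->
  exists nu : {measure set X -> \bar R}, forall A, nu A = pan f A.
Proof.
move=> mm sa.
have p0 := pan0 f (mm_set0 mm).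
have sp := @pan_sigma_additive f mm sa.
pose mix := isMeasure.Build d X R (pan f) p0 (pan_ge0 f) sp.
by exists (HB.pack (pan f) mix : {measure set X -> \bar R}).
Qed.

(** * Comparison with the Lebesgue integral *)

Section integral.
Import HBNNSimple.
Variable nu : {measure set X -> \bar R}.

(** For a simple [h] below [f], [pan_scale] treats each level set of [h], and super-additivity
    assembles the level sets. *)
Lemma integral_le_pan f : mu set0 = 0 -> (forall A, nu A = pan (cst 1) A) ->
  (forall x, 0 <= f x) -> (\int[nu]_x (f x)%:E <= pan f setT)%E.
Proof.
move=> mu0 nuE f0; rewrite ge0_integralTE => [|x]; last by rewrite lee_fin.
apply: ge_ereal_sup => _ [h /= hf <-].
rewrite sintegralE fsbig_finite//=.
have us : uniq (finmap.enum_fset (fset_set (range h))) by exact: finmap.fset_uniq.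
set s := finmap.enum_fset _ in us *.
apply: (@le_trans _ _ (\sum_(r <- s) pan f (h @^-1` [set r]))%E).
  rewrite big_seq_cond [leRHS]big_seq_cond; apply: lee_sum => r /andP[rs _].
  have : [set` fset_set (range h)] r by [].
  (* The value [r] is attained by the nonnegative [h], whence [0 <= r]. *)
  rewrite fset_setK//= => -[x _ hxr].
  rewrite nuE; apply: pan_scale; first by rewrite -hxr.
  by move=> y <-; rewrite -lee_fin.
apply: le_trans (pan_bigsetU _ us _ mu0) _; first exact: trivIset_preimage1.
exact: pan_mono.
Qed.

(** The bound holds term by term and is summed by additivity of the integral, countable in the
    infinite case. Overlapping sets are allowed, so partitions and coverings are treated
    together. *)
Lemma basic_sum_le_integral f (phi : simple R X) : monotone_measure mu ->
  (forall A, measurable A -> ((mu A)%:E <= nu A)%E) ->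
  measurable_fun setT f ->
  match phi with
  | FinSimple n s => forall k, 0 <= (s k).1 /\ measurable (s k).2
  | InfSimple s => forall k, 0 <= (s k).1 /\ measurable (s k).2
  end ->
  (forall x, simple_eval phi x <= (f x)%:E)%E ->
  (basic_sum mu phi <= \int[nu]_x (f x)%:E)%E.
Proof.
move=> mm munu mf.
have mind (r : R) A : measurable A ->
    measurable_fun [set: X] (fun x => (r * \1_A x)%:E).
  by move=> mA; apply/measurable_EFinP; apply: measurable_funM.
have ind0 (r : R) A x : 0 <= r -> (0 <= (r * \1_A x)%:E :> \bar R)%E.
  by move=> r0; rewrite lee_fin mulr_ge0.
have term (r : R) A : 0 <= r -> measurable A ->
    ((r * mu A)%:E <= \int[nu]_x (r * \1_A x)%:E)%E.
  move=> r0 mA; rewrite integralZl_indic// ?integral_indic// ?setIT.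
    by rewrite EFinM lee_wpmul2l// munu.
  by move=> r0'; move: r0; rewrite leNgt r0'.
case: phi => [n s|s] hs sf /=.
- apply: (@le_trans _ _ (\int[nu]_x simple_eval (FinSimple s) x)%E); last first.
    apply: ge0_le_integral => //=.
    + by move=> x _; apply: sume_ge0 => k _; apply: ind0; case: (hs k).
    + by apply: emeasurable_sum => k; apply: mind; case: (hs k).
    + by apply/measurable_EFinP.
    + by move=> x _; exact: sf.
  rewrite /= ge0_integral_sum//.
  + by apply: lee_sum => k _; apply: term; case: (hs k).
  + by move=> k; apply: mind; case: (hs k).
  + by move=> k x _; apply: ind0; case: (hs k).
- apply: (@le_trans _ _ (\int[nu]_x simple_eval (InfSimple s) x)%E); last first.
    apply: ge0_le_integral => //=.
    + by move=> x _; apply: nneseries_ge0 => k _ _; apply: ind0; case: (hs k).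
    + apply: ge0_emeasurable_sum => [k x _ _|k _]; first by apply: ind0; case: (hs k).
      by apply: mind; case: (hs k).
    + by apply/measurable_EFinP.
    + by move=> x _; exact: sf.
  rewrite /= integral_nneseries//.
  + apply: lee_nneseries => [k _ _|k _]; last by apply: term; case: (hs k).
    by have [sk0 msk] := hs k; rewrite lee_fin mulr_ge0// (mm_ge0 mm).
  + by move=> k; apply: mind; case: (hs k).
  + by move=> k x _; apply: ind0; case: (hs k).
Qed.

End integral.

(** * Completing finite families to members of the four classes *)

(** The complement gets coefficient 0, so the union becomes the whole space while the basic sum
    stays the same. *)
Definition pad_partition n (s : 'I_n -> R * set X) (k : 'I_n.+1) : R * set X :=
  if unlift ord0 k is Some j then s j else (0, ~` \bigcup_j (s j).2).

Definition pad_infinite n (s : 'I_n -> R * set X) (k : nat) : R * set X :=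
  if insub k is Some j then s j else (0, set0).

(** By disjointness at most one term is nonzero at [x]; where no set contains [x], the value 0 is
    below [f]. *)
Lemma pan_family_eval f n (s : 'I_n -> R * set X) x :
  (forall x, 0 <= f x) -> pan_family f setT s ->
  (simple_eval (FinSimple s) x <= (f x)%:E)%E.
Proof.
move=> f0 [s0 ms ts _ sf] /=.
have [[j sjx]|nos] := pselect (exists j, (s j).2 x).
  rewrite (bigD1 j)//= big1 => [|k kj].
    by rewrite adde0 lee_fin indicE mem_set// mulr1 sf.
  rewrite indicE memNset ?mulr0// => skx; move/eqP: kj; apply.
  by apply: ts => //; exists x.
rewrite big1 ?lee_fin// => k _; rewrite indicE memNset ?mulr0// => skx.
by apply: nos; exists k.
Qed.

Lemma pad_partitionP f n (s : 'I_n -> R * set X) : (forall x, 0 <= f x) ->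
  pan_family f setT s ->
  pan_family f setT (pad_partition s) /\
  \bigcup_k (pad_partition s k).2 = setT.
Proof.
move=> f0 [s0 ms ts _ sf]; rewrite /pad_partition; split; last first.
  apply/seteqP; split=> // x _.
  have [[j _ sjx]|nos] := pselect ((\bigcup_j (s j).2) x).
    by exists (lift ord0 j) => //; rewrite liftK.
  by exists ord0 => //; rewrite unlift_none.
split=> // [k|k|k l _ _|k x].
- by case: unliftP.
- case: unliftP => // _; apply: measurableC; exact: countable_bigcupT_measurable.
- case: (unliftP ord0 k) => [i ->|->]; case: (unliftP ord0 l) => [j ->|->] //= [x []].
  + by move=> six sjx; congr lift; apply: ts => //; exists x.
  + by move=> six []; exists i.
  + by move=> + sjx; case; exists j.
- by case: unliftP => [j _|_ _]; [exact: sf|exact: f0].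
Qed.

Lemma pad_partition_sum n (s : 'I_n -> R * set X) :
  basic_sum mu (FinSimple (pad_partition s)) = basic_sum mu (FinSimple s).
Proof.
rewrite /= big_ord_recl /pad_partition unlift_none mul0r add0e.
by apply: eq_bigr => k _; rewrite liftK.
Qed.

(** The weight [F] is abstract so that one computation serves both the basic sum and the evaluation
    at a point. *)
Lemma pad_infinite_series (F : R * set X -> R) n (s : 'I_n -> R * set X) :
  F (0, set0) = 0 -> (forall k, 0 <= F (s k)) ->
  (\sum_(0 <= k <oo) (F (pad_infinite s k))%:E = \sum_(k < n) (F (s k))%:E)%E.
Proof.
move=> F0 Fs; rewrite (nneseries_split 0 n) => [|k _]; last first.
  by rewrite lee_fin /pad_infinite; case: insub => [j|]; rewrite ?F0.
rewrite add0n [X in (_ + X)%E]eseries0 ?adde0 => [|k nk _].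
  by rewrite big_mkord; apply: eq_bigr => k _; rewrite /pad_infinite valK.
by rewrite /pad_infinite insubF ?F0// ltnNge nk.
Qed.

(** A partition is a covering, so the padded finite family serves both finite classes, and its
    infinite extension both infinite ones. *)
Lemma pan_le_lower_integral f (S : set (simple R X)) : monotone_measure mu ->
  (forall x, 0 <= f x) ->
  [\/ S = @SPfin R d X, S = SPinf mu, S = @SCfin R d X | S = SCinf mu] ->
  (pan f setT <= lower_integral S mu f)%E.
Proof.
move=> mm f0 hS; apply: ge_ereal_sup => v [n [s [sP ->]]].
have [tP tT] := pad_partitionP f0 sP.
rewrite -pad_partition_sum; set t := pad_partition s in tP tT *.
have ef x := pan_family_eval x f0 tP.
have [t0 mt tt _ _] := tP.
have sumE : basic_sum mu (InfSimple (pad_infinite t)) = basic_sum mu (FinSimple t).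
  apply: (pad_infinite_series (F := fun p => p.1 * mu p.2)) => [|k].
    by rewrite mul0r.
  by rewrite mulr_ge0// (mm_ge0 mm).
have evalE x : simple_eval (InfSimple (pad_infinite t)) x = simple_eval (FinSimple t) x.
  apply: (pad_infinite_series (F := fun p => p.1 * \1_(p.2) x)) => [|k].
    by rewrite mul0r.
  by rewrite mulr_ge0.
have u0 k : 0 <= (pad_infinite t k).1.
  by rewrite /pad_infinite; case: insub => [j|] /=.
have ufin : (basic_sum mu (InfSimple (pad_infinite t)) < +oo)%E.
  by rewrite sumE /= sumEFin ltry.
have um k : measurable (pad_infinite t k).2.
  by rewrite /pad_infinite; case: insub => [j|] /=.
have ut : trivIset setT (fun k => (pad_infinite t k).2).
  rewrite /pad_infinite => i j _ _ [x []].
  case: insubP => // k _ <-; case: insubP => // l _ <- /= tkx tlx.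
  by congr val; apply: tt => //; exists x.
have uT : \bigcup_k (pad_infinite t k).2 = setT.
  apply/seteqP; split=> // x _; have : setT x by [].
  rewrite -tT => -[k _ tkx]; exists (val k) => //.
  by rewrite /pad_infinite valK.
case: hS => ->; apply: ereal_sup_ubound.
- by exists (FinSimple t).
- by exists (InfSimple (pad_infinite t)) => //; split=> [//|x]; rewrite evalE.
- by exists (FinSimple t).
- by exists (InfSimple (pad_infinite t)) => //; split=> [//|x]; rewrite evalE.
Qed.

End pan.

(** * Representation by a measure and passage to the limit *)

(** The measure is chosen before [f]: a single [nu] represents the integrals of all [f_ n] and of
    their limit. *)
Lemma lower_integralE (R : realType) (d : measure_display)
    (X : measurableType d) (mu : set X -> R) (S : set (simple R X)) :
  monotone_measure mu -> sub_additive mu ->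
  [\/ S = @SPfin R d X, S = SPinf mu, S = @SCfin R d X | S = SCinf mu] ->
  exists nu : {measure set X -> \bar R}, forall f : X -> R,
    measurable_fun setT f -> (forall x, 0 <= f x) ->
    lower_integral S mu f = (\int[nu]_x (f x)%:E)%E.
Proof.
move=> mm sa hS; have [nu nuE] := pan_measure (cst 1) mm sa.
exists nu => f mf f0; apply/eqP; rewrite eq_le; apply/andP; split; last first.
  apply: le_trans (pan_le_lower_integral mm f0 hS).
  exact: integral_le_pan (mm_set0 mm) nuE f0.
have munu A : measurable A -> ((mu A)%:E <= nu A)%E.
  by move=> mA; rewrite nuE -[mu A]mul1r; exact: le_pan.
apply: ge_ereal_sup => _ [phi [Sphi phif] <-].
apply: basic_sum_le_integral => //.
case: phi Sphi {phif} => [n s|s].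
- by case: hS => -> //= -[s0 []] ms *; split.
- by case: hS => -> //= -[s0 _ []] ms *; split.
Qed.

Theorem theorem17 (R : realType) (d : measure_display) (X : measurableType d)
    (mu : set X -> R) (f_ : nat -> X -> R) (f : X -> R)
    (S : set (simple R X)) :
  monotone_measure mu ->
  sub_additive mu ->
  (forall n, measurable_fun setT (f_ n)) ->
  (forall n x, 0 <= f_ n x) ->
  (forall x, nonincreasing_seq (fun n => f_ n x)) ->
  (forall x, f_ n x @[n --> \oo] --> f x) ->
  [\/ S = @SPfin R d X, S = SPinf mu, S = @SCfin R d X | S = SCinf mu] ->
  (lower_integral S mu (f_ 0%N) < +oo)%E ->
  nonincreasing_seq (fun n => lower_integral S mu (f_ n)) /\
  (lower_integral S mu (f_ n) @[n --> \oo] --> lower_integral S mu f).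
Proof.
move=> mm sa mf f0 fdec fcv hS foo; split.
  (* Monotonicity comes directly from the supremum: whatever lies below [f_ n] lies below [f_ m]. *)
  move=> m n mn; apply: ereal_sup_le => _ [phi [Sphi phif] <-].
  by exists phi => //; split=> // x; apply: le_trans (phif x) _; rewrite lee_fin fdec.
have [nu nuE] := lower_integralE mm sa hS.
have mlim : measurable_fun setT f by apply: (measurable_fun_cvg mf) => x _; exact: fcv.
have lim0 x : 0 <= f x.
  rewrite -(cvg_lim _ (fcv x))//; apply: limr_ge; first by apply/cvg_ex; exists (f x).
  by near=> n; exact: f0.
rewrite nuE//; under eq_fun do rewrite nuE//.
apply: (@dominated_cvg _ _ _ nu setT measurableT (fun n x => (f_ n x)%:E) _
  (fun x => (f_ 0%N x)%:E)) => //.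
- by move=> n; apply/measurable_EFinP.
- by move=> x _; apply: cvg_EFin; [near=> n|exact: fcv].
(* The dominating function is [f_ 0]; through [nuE] its integrability is the finiteness hypothesis
   [foo]. *)
- apply/integrableP; split; first by apply/measurable_EFinP.
  under eq_integral do rewrite gee0_abs ?lee_fin//.
  by rewrite -nuE.
- by move=> n x _; rewrite gee0_abs ?lee_fin// fdec.
Unshelve. all: by end_near.
Qed.
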